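(* Consider a finite MDP $\langle\mathcal S,\mathcal A,(\mathcal A(s),s\in\mathcal S),P,r\rangle$ such that the Markov chain under every randomized stationary policy is ergodic (irreducible and aperiodic), and let $\alpha\in(0,1]$. A policy $u^*\in\mathcal U^{\rm DS}$ is optimal for the steady-state VaR maximization MDP, i.e. $\mathrm{VaR}^{u^*}=\max_{u\in\mathcal U^{\rm DS}}\mathrm{VaR}^u$, if and only if $F^*(\mathrm{VaR}^{u^*})\ge\alpha$, where $F^*(\lambda):=\min_{u\in\mathcal U^{\rm DS}}F^u(\lambda)$ for $\lambda\in\mathbb R$.
   Context: MDP: $\mathcal S$ and $\mathcal A$ are finite sets; $\mathcal A(s)\subseteq\mathcal A$ is the nonempty set of admissible actions in $s$, with $\cup_s\mathcal A(s)=\mathcal A$; $\mathcal K:=\{(s,a):s\in\mathcal S,a\in\mathcal A(s)\}$; $P(\cdot|s,a)$ is a probability distribution on $\mathcal S$ for each $(s,a)\in\mathcal K$; $r:\mathcal K\to\mathbb R$ is the reward function. Policies: $\mathcal U^{\rm RS}$ is the set of randomized stationary policies, i.e. maps $s\mapsto u(\cdot|s)$ with $u(\cdot|s)$ a probability distribution on $\mathcal A(s)$; $\mathcal U^{\rm DS}$ is the subset of deterministic ones (maps $u:\mathcal S\to\mathcal A$ with $u(s)\in\mathcal A(s)$). Under $u$, the state process is a Markov chain on $\mathcal S$ with transition matrix $\sum_{a}u(a|s)P(s'|s,a)$, and $\pi^u(s,a):=\lim_{t\to\infty}\mathbb P^u_{s_0}(s_t=s,a_t=a)$, which by ergodicity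 exists and does not depend on $s_0$. Steady-state quantities: $R^u_\infty$ is the random variable $r(s,a)$ with $(s,a)\sim\pi^u$; for $\lambda\in\mathbb R$, $F^u(\lambda):=\mathbb P(R^u_\infty\le\lambda)$; $\mathrm{VaR}^u:=\inf\{\lambda\in\mathbb R:F^u(\lambda)\ge\alpha\}$. *)

(* Defs.v *)
From HB Require Import structures.
From mathcomp Require Export all_boot all_order all_algebra.
From mathcomp Require Export all_classical all_reals all_analysis.
Export Order.TTheory GRing.Theory Num.Theory.
Export numFieldNormedType.Exports.

#[export] Set Implicit Arguments.
#[export] Unset Strict Implicit.
#[export] Unset Printing Implicit Defensive.

Local Open Scope classical_set_scope.
Local Open Scope ring_scope.

(* [trans] and [reward] are total functions, but everything below reads them
   only at admissible pairs, i.e. those with [a \in adm s]. *)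
Record mdp (R : realType) (S A : finType) := MDP {
  adm : S -> {set A};
  trans : S -> A -> S -> R;
  reward : S -> A -> R;
  adm_neq0 : forall s, adm s != finset.set0;
  adm_cover : (\bigcup_(s : S) adm s)%SET = [set: A]%SET;
  trans_ge0 : forall s a, a \in adm s -> forall s', 0 <= trans s a s';
  trans_sum1 : forall s a, a \in adm s -> \sum_s' trans s a s' = 1
}.

(* [u s a] stands for u(a|s); a distribution on [adm s] is encoded as a
   distribution on [A] supported in [adm s]. *)
Definition is_rs_policy (R : realType) (S A : finType) (M : mdp R S A)
    (u : S -> A -> R) : Prop :=
  forall s, [/\ forall a, 0 <= u s a,
                forall a, a \notin adm M s -> u s a = 0
              & \sum_(a in adm M s) u s a = 1].

Definition ds_policy (R : realType) (S A : finType) (M : mdp R S A) :=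
  {u : {ffun S -> A} | [forall s, u s \in adm M s]}.

Definition rs_of_ds (R : realType) (S A : finType) (M : mdp R S A)
    (u : ds_policy M) : S -> A -> R :=
  fun s a => (a == val u s)%:R.

Lemma rs_of_dsP (R : realType) (S A : finType) (M : mdp R S A)
    (u : ds_policy M) : is_rs_policy M (rs_of_ds u).
Proof.
have uM s : val u s \in adm M s by exact: (forallP (valP u) s).
move=> s; split=> [a|a aM|]; rewrite /rs_of_ds.
- exact: ler0n.
- by case: eqP => // aE; rewrite aE uM in aM.
- by rewrite (bigD1 (val u s)) //= eqxx big1 ?addr0 // => a /andP[_ /negbTE->].
Qed.

(* An arbitrary deterministic policy, used only to seed the finite maxima and
   minima over [ds_policy M], whose values do not depend on it. *)
Definition ds_default_fun (R : realType) (S A : finType) (M : mdp R S A) :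
    {ffun S -> A} :=
  [ffun s => xchoose (set0Pn _ (adm_neq0 M s))].

Lemma ds_default_subproof (R : realType) (S A : finType) (M : mdp R S A) :
  [forall s, ds_default_fun M s \in adm M s].
Proof. by apply/forallP => s; rewrite ffunE; apply: xchooseP. Qed.

Definition ds_default (R : realType) (S A : finType) (M : mdp R S A) :
    ds_policy M :=
  Sub (ds_default_fun M) (ds_default_subproof M).

Definition chain (R : realType) (S A : finType) (M : mdp R S A)
    (u : S -> A -> R) (s s' : S) : R :=
  \sum_(a in adm M s) u s a * trans M s a s'.

Fixpoint nstep (R : realType) (S : finType) (p : S -> S -> R) (n : nat)
    (s s' : S) : R :=
  if n is m.+1 then \sum_x p s x * nstep p m x s' else (s == s')%:R.

Definition irreducible_chain (R : realType) (S : finType) (p : S -> S -> R) :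
    Prop :=
  forall s s', exists n, 0 < nstep p n s s'.

Definition common_return_divisor (R : realType) (S : finType)
    (p : S -> S -> R) (s : S) (d : nat) : Prop :=
  forall n, (0 < n)%N -> 0 < nstep p n s s -> (d %| n)%N.

(* [d] is the gcd of the return times to [s] (0 if there are none). *)
Definition is_period (R : realType) (S : finType) (p : S -> S -> R) (s : S)
    (d : nat) : Prop :=
  common_return_divisor p s d /\
  forall d', common_return_divisor p s d' -> (d' %| d)%N.

Definition aperiodic_chain (R : realType) (S : finType) (p : S -> S -> R) :
    Prop :=
  forall s, is_period p s 1%N.

Definition ergodic_mdp (R : realType) (S A : finType) (M : mdp R S A) : Prop :=
  forall u, is_rs_policy M u ->
    irreducible_chain (chain M u) /\ aperiodic_chain (chain M u).

(* Probability of (s_t, a_t) = (s, a) under [u], starting from [s0]. *)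
Definition occupation (R : realType) (S A : finType) (M : mdp R S A) (s0 : S)
    (u : S -> A -> R) (t : nat) (s : S) (a : A) : R :=
  nstep (chain M u) t s0 s * u s a.

(* The limit exists and is independent of [s0] when [M] is ergodic. *)
Definition steady_state (R : realType) (S A : finType) (M : mdp R S A)
    (s0 : S) (u : S -> A -> R) (s : S) (a : A) : R :=
  limn (fun t => occupation M s0 u t s a).

(* Distribution function of [reward M s a] for (s, a) drawn from
   [steady_state M s0 u]. *)
Definition reward_cdf (R : realType) (S A : finType) (M : mdp R S A) (s0 : S)
    (u : S -> A -> R) (l : R) : R :=
  \sum_(s : S) \sum_(a in adm M s | reward M s a <= l) steady_state M s0 u s a.

Definition VaR (R : realType) (S A : finType) (M : mdp R S A) (s0 : S)
    (alpha : R) (u : S -> A -> R) : R :=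
  inf [set l : R | alpha <= reward_cdf M s0 u l].

Definition max_VaR (R : realType) (S A : finType) (M : mdp R S A) (s0 : S)
    (alpha : R) : R :=
  \big[Num.max/VaR M s0 alpha (rs_of_ds (ds_default M))]_(u : ds_policy M)
    VaR M s0 alpha (rs_of_ds u).

Definition min_cdf (R : realType) (S A : finType) (M : mdp R S A) (s0 : S)
    (l : R) : R :=
  \big[Num.min/reward_cdf M s0 (rs_of_ds (ds_default M)) l]_(u : ds_policy M)
    reward_cdf M s0 (rs_of_ds u) l.

(* Main.v *)
Require Import Defs.
From mathcomp Require Import all_boot all_order all_algebra.
From mathcomp Require Import all_classical all_reals all_analysis.
From mathcomp Require Import lra.
Import Order.TTheory GRing.Theory Num.Theory.
Local Open Scope classical_set_scope.
Local Open Scope ring_scope.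

(* The distribution function F of the steady-state reward is a nondecreasing
   step function from 0 to 1, so its quantile satisfies
   [VaR <= l <-> alpha <= F l]; both sides of the theorem then say that
   [VaR u <= VaR ustar] for every deterministic u. That F has total mass 1
   needs the occupation probabilities to converge. By aperiodicity and
   irreducibility some power of the transition matrix has all entries at least
   e > 0, and applying it shrinks the range (max - min) over initial states of
   p^n(., y) by a factor 1 - e, while the max decreases and the min increases
   with n. *)

(** The least positive gap [d] between two elements of [T] divides every element of [T], so it is 1.
    Two consecutive elements [a] and [a + 1] then generate every [n >= a * a]. *)
Lemma add_closed_gcd1_cofinite (T : pred nat) : T 0 ->
  (forall m n, T m -> T n -> T (m + n)%N) ->
  (forall d, (forall n, T n -> d %| n)%N -> d %| 1)%N ->
  exists N, forall n, (N <= n)%N -> T n.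
Proof.
move=> T0 TD T1.
have TM k m : T m -> T (k * m)%N.
  by move=> Tm; elim: k => [//|k IHk]; rewrite mulSn; apply: TD.
pose gap d := `[< (0 < d)%N /\ exists a, T a /\ T (a + d)%N >].
have gapP : exists d, gap d.
  (* Without gaps [T] contains only 0, whose common divisors include 0. *)
  apply: contrapT => nogap; suff : (0 %| 1)%N by [].
  apply: T1 => n Tn; rewrite dvd0n; apply: contrapT => n0; apply: nogap.
  by exists n; apply/asboolP; split; [rewrite lt0n; apply/negP | exists 0%N].
case: (ex_minnP gapP) => d /asboolP[d0 [a [Ta Tad]]] dmin.
(* For [m] in [T], the pair [m %/ d * (a + d)], [m %/ d * a + m] of elements of
   [T] differs by [m %% d], which minimality of [d] forces to be 0. *)
have dT m : T m -> (d %| m)%N.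
  move=> Tm; apply: contrapT => dm; have := ltn_pmod m d0.
  rewrite ltnNge => /negP; apply; apply: dmin; apply/asboolP.
  split; first by rewrite lt0n; apply/negP.
  exists (m %/ d * (a + d))%N; split; first exact: TM.
  by rewrite mulnDr -addnA -divn_eq; apply: TD => //; apply: TM.
have d1 : d = 1%N by apply/eqP; rewrite -dvdn1; apply: T1.
rewrite d1 addn1 in Tad; exists (a * a)%N => n an.
case: (posnP a) => [a0|a0]; first by rewrite -(muln1 n) TM// -[1%N]/(0.+1) -a0.
(* With [n = q * a + r] and [r < a <= q], one gets [n = (q - r) * a + r * (a + 1)]. *)
have rq : (n %% a <= n %/ a)%N.
  by rewrite (leq_trans (ltnW (ltn_pmod n a0)))// leq_divRL.
have -> : n = ((n %/ a - n %% a) * a + n %% a * a.+1)%N.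
  by rewrite mulnS addnCA addnC -mulnDl subnK// -divn_eq.
by apply: TD; apply: TM.
Qed.

Definition stochastic (R : realType) (S : finType) (p : S -> S -> R) :=
  (forall x y, 0 <= p x y) /\ (forall x, \sum_y p x y = 1).

Lemma nstep_stochastic (R : realType) (S : finType) (p : S -> S -> R) n :
  stochastic p -> stochastic (nstep p n).
Proof.
move=> [p0 p1]; elim: n => [|n [IH0 IH1]]; split=> [x y|x] /=.
- exact: ler0n.
- rewrite (bigD1 x)//= eqxx big1 ?addr0// => y /negbTE.
  by rewrite eq_sym => ->.
- by apply: sumr_ge0 => z _; apply: mulr_ge0.
- rewrite exchange_big /= -[RHS](p1 x); apply: eq_bigr => z _.
  by rewrite -mulr_sumr IH1 mulr1.
Qed.

Lemma nstepD (R : realType) (S : finType) (p : S -> S -> R) m n x y :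
  nstep p (m + n) x y = \sum_z nstep p m x z * nstep p n z y.
Proof.
elim: m x => [|m IHm] x /=.
  rewrite (bigD1 x)//= eqxx mul1r big1 ?addr0// => z /negbTE.
  by rewrite eq_sym => ->; rewrite mul0r.
under eq_bigr do rewrite IHm mulr_sumr.
rewrite exchange_big /=; apply: eq_bigr => z _.
by rewrite mulr_suml; apply: eq_bigr => w _; rewrite mulrA.
Qed.

Lemma nstepD_gt0 (R : realType) (S : finType) (p : S -> S -> R) m n x y z :
  stochastic p -> 0 < nstep p m x y -> 0 < nstep p n y z ->
  0 < nstep p (m + n) x z.
Proof.
move=> p01 xy yz; rewrite nstepD (bigD1 y)//= ltr_wpDr ?mulr_gt0//.
apply: sumr_ge0 => w _.
by apply: mulr_ge0; [case: (nstep_stochastic m p01)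
                    | case: (nstep_stochastic n p01)].
Qed.

(** From [x], spend the first [N - k (x, y)] steps on a return to [x], which is possible once this
    number is at least [n0 x], then go to [y] in [k (x, y)] steps. *)
Lemma nstep_eventually_gt0 (R : realType) (S : finType) (p : S -> S -> R) :
  stochastic p -> irreducible_chain p -> aperiodic_chain p ->
  exists N, forall x y, 0 < nstep p N x y.
Proof.
move=> p01 irr aper.
have /choice[n0 n0P] x : exists N, forall n, (N <= n)%N -> 0 < nstep p n x x.
  apply: add_closed_gcd1_cofinite => [|m n|d dP].
  - by rewrite /= eqxx ltr01.
  - exact: nstepD_gt0.
  - by apply: (aper x).2 => n _; apply: dP.
have /choice[k kP] (xy : S * S) : exists n, 0 < nstep p n xy.1 xy.2.
  exact: irr.
pose F xy := (n0 xy.1 + k xy)%N.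
exists (\max_xy F xy)%N => x y; have le_N := @leq_bigmax _ F (x, y).
have kN := leq_trans (leq_addl _ _) le_N.
rewrite -(subnK kN); apply: nstepD_gt0 (kP (x, y)) => //; apply: n0P.
by rewrite leq_subRL// addnC.
Qed.

(** The extrema are values of [f] at chosen points, so any property of all values of [f] applies to
    them directly; [s0] witnesses that [S] is nonempty. *)
Definition fmin (R : realType) (S : finType) (s0 : S) (f : S -> R) :=
  f [arg min_(x < s0) f x]%O.
Definition fmax (R : realType) (S : finType) (s0 : S) (f : S -> R) :=
  f [arg max_(x > s0) f x]%O.

Lemma fmin_le (R : realType) (S : finType) (s0 : S) (f : S -> R) x :
  fmin s0 f <= f x.
Proof. by rewrite /fmin; case: arg_minP => // y _; apply. Qed.

Lemma fmax_ge (R : realType) (S : finType) (s0 : S) (f : S -> R) x :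
  f x <= fmax s0 f.
Proof. by rewrite /fmax; case: arg_maxP => // y _; apply. Qed.

Lemma avg_ge_fmin (R : realType) (S : finType) (s0 : S) (w f : S -> R) :
  (forall x, 0 <= w x) -> \sum_x w x = 1 ->
  fmin s0 f <= \sum_x w x * f x.
Proof.
move=> w0 w1; rewrite -[leLHS]mul1r -w1 mulr_suml.
by apply: ler_sum => x _; rewrite ler_wpM2l ?fmin_le.
Qed.

(** The minimizer of [f] carries weight at least [e], which alone pulls the average below the
    maximum by [e] times the range; the other points can only lower it further. *)
Lemma avg_le_fmax (R : realType) (S : finType) (s0 : S) (e : R)
    (w f : S -> R) : 0 <= e -> (forall x, e <= w x) -> \sum_x w x = 1 ->
  \sum_x w x * f x <= fmax s0 f - e * (fmax s0 f - fmin s0 f).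
Proof.
move=> e0 ew w1; set m := [arg min_(x < s0) f x]%O.
have w0 x : 0 <= w x := le_trans e0 (ew x).
have : \sum_x w x * (fmax s0 f - f x) >= e * (fmax s0 f - fmin s0 f).
  rewrite (bigD1 m)//= ler_wpDr ?ler_pM ?subr_ge0 ?fmax_ge//.
  by apply: sumr_ge0 => x _; rewrite mulr_ge0 ?subr_ge0 ?fmax_ge.
under [X in _ <= X -> _]eq_bigr do rewrite mulrBr.
by rewrite sumrB -mulr_suml w1; lra.
Qed.

Lemma nstep_is_cvg (R : realType) (S : finType) (p : S -> S -> R) :
  stochastic p -> irreducible_chain p -> aperiodic_chain p ->
  forall x y, cvgn (fun n => nstep p n x y).
Proof.
move=> p01 irr aper x y; have [N Npos] := nstep_eventually_gt0 p01 irr aper.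
(* The least entry of the [N]-step matrix. *)
pose e := fmin x (fun z => fmin x (nstep p N z)).
have e0 : 0 < e by apply: Npos.
have eN z z' : e <= nstep p N z z'.
  apply: le_trans (fmin_le x _ z').
  exact: (fmin_le x (fun z => fmin x (nstep p N z))).
pose hi n := fmax x (nstep p n ^~ y); pose lo n := fmin x (nstep p n ^~ y).
have nstep01 n z : 0 <= nstep p n z y <= 1.
  have [n0 n1] := nstep_stochastic n p01; rewrite n0 -(n1 z) (bigD1 y)//= lerDl.
  exact: sumr_ge0.
have lohi n : lo n <= nstep p n x y <= hi n.
  by rewrite (fmin_le x (nstep p n ^~ y)) (fmax_ge x (nstep p n ^~ y)).
(* Row [z] of the [k]-step matrix averages the column [nstep p n ^~ y]. Taking [d = 0], [k = 1]
   gives monotonicity, and [d = e], [k = N] the contraction. *)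
have avg_hi (d : R) k n : 0 <= d -> (forall z z', d <= nstep p k z z') ->
    hi (k + n)%N <= hi n - d * (hi n - lo n).
  move=> d0 dk; rewrite {1}/hi /fmax nstepD; apply: avg_le_fmax => //.
  exact: (nstep_stochastic k p01).2.
have avg_lo k n : lo n <= lo (k + n)%N.
  rewrite {2}/lo /fmin nstepD; have [k0 k1] := nstep_stochastic k p01.
  exact: avg_ge_fmin.
have hi_cvg : cvgn hi.
  apply: nonincreasing_is_cvgn.
    apply/nonincreasing_seqP => n.
    have := avg_hi 0 1%N n (lexx _) (nstep_stochastic 1 p01).1.
    by rewrite mul0r subr0.
  exists 0 => _ [n _ <-].
  by case/andP: (nstep01 n [arg max_(z > x) nstep p n z y]%O).
have lo_cvg : cvgn lo.
  apply: nondecreasing_is_cvgn.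
    by apply/nondecreasing_seqP => n; apply: (avg_lo 1%N).
  exists 1 => _ [n _ <-].
  by case/andP: (nstep01 n [arg min_(z < x) nstep p n z y]%O).
have gap0 : limn hi = limn lo.
  have hlo : limn lo <= limn hi.
    apply: ler_lim => //; near=> n.
    by have /andP[/le_trans h /h] := lohi n.
  (* This is the limit of the [N]-step contraction; since [e > 0], it leaves no room for a positive
     gap. *)
  have : limn hi <= limn hi - e * (limn hi - limn lo).
    apply: (@ler_cvg_to _ \oo _ _ (fun n => hi (n + N)%N)
              (fun n => hi n - e * (hi n - lo n))).
    - exact: cvg_comp (cvg_addnr N) hi_cvg.
    - by apply: cvgB => //; apply: cvgMl_tmp; apply: cvgB.
    - by near=> n; rewrite addnC; apply: avg_hi => //; exact: ltW.
  rewrite lerBrDr gerDl pmulr_rle0// subr_le0 => hilo.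
  by apply/eqP; rewrite eq_le hilo.
apply/cvg_ex; exists (limn hi); apply: squeeze_cvgr hi_cvg.
- by near=> n; apply: lohi.
- by rewrite gap0.
Unshelve. all: by end_near. Qed.

Lemma chain_stochastic (R : realType) (S A : finType) (M : mdp R S A)
    (u : S -> A -> R) : is_rs_policy M u -> stochastic (chain M u).
Proof.
move=> uP; split=> [s s'|s]; have [u0 _ u1] := uP s.
  by apply: sumr_ge0 => a aM; rewrite mulr_ge0 ?trans_ge0.
rewrite exchange_big /= -[RHS]u1; apply: eq_bigr => a aM.
by rewrite -mulr_sumr trans_sum1 ?mulr1.
Qed.

Lemma occupation_is_cvg (R : realType) (S A : finType) (M : mdp R S A)
    (s0 : S) (u : S -> A -> R) s a : ergodic_mdp M -> is_rs_policy M u ->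
  cvgn (fun t => occupation M s0 u t s a).
Proof.
move=> hM uP; have [irr aper] := hM u uP.
have /cvg_ex[l pl] : cvgn (fun t => nstep (chain M u) t s0 s).
  by apply: nstep_is_cvg => //; apply: chain_stochastic.
by apply/cvg_ex; exists (l * u s a); apply: cvgMr_tmp.
Qed.

Lemma steady_state_ge0 (R : realType) (S A : finType) (M : mdp R S A)
    (s0 : S) (u : S -> A -> R) s a : ergodic_mdp M -> is_rs_policy M u ->
  0 <= steady_state M s0 u s a.
Proof.
move=> hM uP; apply: limr_ge; first exact: occupation_is_cvg.
near=> t; have [u0 _ _] := uP s.
by rewrite mulr_ge0 ?(nstep_stochastic t (chain_stochastic uP)).1.
Unshelve. all: by end_near. Qed.

Lemma steady_state_sum1 (R : realType) (S A : finType) (M : mdp R S A)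
    (s0 : S) (u : S -> A -> R) : ergodic_mdp M -> is_rs_policy M u ->
  \sum_s \sum_(a in adm M s) steady_state M s0 u s a = 1.
Proof.
move=> hM uP.
have sum_cvg : \sum_s \sum_(a in adm M s) occupation M s0 u t s a @[t --> \oo]
    --> \sum_s \sum_(a in adm M s) steady_state M s0 u s a.
  apply: cvg_big => [|s _]; first exact: add_continuous.
  apply: cvg_big => [|a _]; first exact: add_continuous.
  exact: occupation_is_cvg.
have occ1 t : \sum_s \sum_(a in adm M s) occupation M s0 u t s a = 1.
  rewrite -[RHS]((nstep_stochastic t (chain_stochastic uP)).2 s0).
  apply: eq_bigr => s _; rewrite -mulr_sumr.
  by have [_ _ ->] := uP s; rewrite mulr1.
move: sum_cvg; under eq_fun do rewrite occ1.
by move/cvg_lim => <-//; rewrite lim_cst.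
Qed.

Lemma reward_cdf_le (R : realType) (S A : finType) (M : mdp R S A)
    (s0 : S) (u : S -> A -> R) (l l' : R) :
  ergodic_mdp M -> is_rs_policy M u -> l <= l' ->
  reward_cdf M s0 u l <= reward_cdf M s0 u l'.
Proof.
move=> hM uP ll'; apply: ler_sum => s _.
rewrite !big_mkcondr; apply: ler_sum => a _.
case: ifP => [/le_trans -> //|_]; case: ifP => // _; exact: steady_state_ge0.
Qed.

(** The set [E] is upward closed by monotonicity of F, and it contains its infimum because F jumps
    only at rewards. *)
Lemma VaR_le (R : realType) (S A : finType) (M : mdp R S A)
    (s0 : S) (alpha : R) (u : S -> A -> R) (l : R) :
  ergodic_mdp M -> 0 < alpha -> alpha <= 1 -> is_rs_policy M u ->
  (VaR M s0 alpha u <= l) = (alpha <= reward_cdf M s0 u l).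
Proof.
move=> hM alpha0 alpha1 uP.
pose r (x : S * A) := reward M x.1 x.2.
set E := [set l : R | alpha <= reward_cdf M s0 u l].
have E0 : E !=set0.
  (* Whatever the seed 0, this bound dominates all rewards, so F equals 1 there. *)
  exists (\big[Num.max/0]_x r x); rewrite /E /= /reward_cdf.
  rewrite (le_trans alpha1)// -(steady_state_sum1 s0 hM uP).
  apply: ler_sum => s _; rewrite [leRHS]big_mkcondr.
  by apply: ler_sum => a _; rewrite (le_bigmax _ r (s, a)).
have lbE : has_lbound E.
  (* Strictly below this bound lies no reward, so F vanishes and cannot reach [alpha > 0]. *)
  exists (\big[Num.min/0]_x r x) => l' El'; rewrite leNgt; apply/negP => l'r.
  suff F0 : reward_cdf M s0 u l' = 0.
    by move: El'; rewrite /E /= F0 leNgt alpha0.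
  rewrite /reward_cdf big1// => s _; apply: big_pred0 => a.
  rewrite [_ <= l']leNgt (lt_le_trans l'r) ?andbF//.
  exact: (bigmin_le _ (s, a) r).
(* No reward lies in ]inf E, inf E + d[, so F is constant there. *)
have EVaR : E (inf E).
  (* The distance from [inf E] to the next reward, capped at 1 so that it stays positive when no
     reward lies above. *)
  pose d := \big[Num.min/1]_(x | inf E < r x) (r x - inf E).
  have d0 : 0 < d by apply/bigmin_gtP; split=> // x; rewrite subr_gt0.
  have [l' El' l'd] := inf_adherent d0 (conj E0 lbE).
  suff -> : E (inf E) = E l' by [].
  congr (_ <= _ = true); apply: eq_bigr => s _; apply: eq_bigl => a.
  congr (_ && _); apply/idP/idP => [|ral'].
    by move/le_trans; apply; apply: ge_inf.
  rewrite leNgt; apply/negP => ra.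
  have := @bigmin_le_cond _ _ _ 1 (s, a) (fun x => inf E < r x)
    (fun x => r x - inf E) ra.
  by rewrite -/d /r /=; lra.
rewrite /VaR -/E; apply/idP/idP => [/(reward_cdf_le s0 hM uP)|].
  exact: le_trans.
by move=> El; apply: ge_inf.
Qed.

Theorem theorem3 (R : realType) (S A : finType) (M : mdp R S A)
    (hM : ergodic_mdp M) (s0 : S) (alpha : R) (halpha0 : 0 < alpha)
    (halpha1 : alpha <= 1) (ustar : ds_policy M) :
  VaR M s0 alpha (rs_of_ds ustar) = max_VaR M s0 alpha <->
  alpha <= min_cdf M s0 (VaR M s0 alpha (rs_of_ds ustar)).
Proof.
have VaRP (u : ds_policy M) l := VaR_le s0 l hM halpha0 halpha1 (rs_of_dsP u).
split=> [-> | /bigmin_geP[_ cdf_ge]].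
  by apply/bigmin_geP; split=> [|u _]; rewrite -VaRP;
    apply: (le_bigmax _ (fun u => VaR M s0 alpha (rs_of_ds u))).
apply/eqP; rewrite eq_le; apply/andP; split.
  exact: (le_bigmax _ (fun u => VaR M s0 alpha (rs_of_ds u))).
by apply/bigmax_leP; split=> [|u _]; rewrite VaRP cdf_ge.
Qed.
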